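(* Suppose the machines have $K$ speed classes with speeds $\sigma_1>\sigma_2>\dots>\sigma_K$, $m_\ell$ machines of speed $\sigma_\ell$, satisfying (1) $\sigma_\ell/\sigma_{\ell+1}\ge64$ for every $\ell<K$, and (2) $m_\ell\sigma_\ell\ge2(m_1\sigma_1+\dots+m_{\ell-1}\sigma_{\ell-1})$ for every $\ell$. Then the rate-assignment algorithm described in the context is $O(K^2)$-competitive on instances consisting of a single job.
   Context: Bag-of-tasks scheduling on related machines: machines with speeds $s_1\ge\dots\ge s_m>0$, $S_k:=s_1+\dots+s_k$ ($S_k:=S_m$ for $k>m$). A job $j$ has weight $w_j>0$ and a finite set of tasks with processing requirements $p_v\ge0$, released at time $0$. Tasks may be preempted and migrated; a task runs on at most one machine at a time, different tasks may run concurrently; a machine of speed $s$ running a task for $\varepsilon$ time does $s\varepsilon$ units of processing on it. A job completes when all its tasks have finished; the objective is $\sum_j w_jC_j$ (for a single job, $w_j$ times its completion time). Non-clairvoyance: $p_v$ is learned only when $v$ finishes. Competitive ratio: supremum over instances of (algorithm's objective)/(optimal offline objective on the same machines). Algorithm: at each time $t$, with $T^t(j)$ the alive tasks of job $j$, raise $\tau$ from $0$; each unfrozen alive task $v\in T^t(j)$ has tentative rate $L^t_v=\frac{w_j}{|T^t(j)|}\tau$; whenever a subset $V$ of alive tasks satisfies $\sum_{v\in V}L^t_v=S_{|V|}$, a maximal such set is frozen with its current rates; continue until all are frozen. Each alive task is processed at rate $L^t_v$. *)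

(* Defs.v *)
From HB Require Import structures.
From mathcomp Require Import all_boot all_order all_algebra.
From mathcomp Require Import all_classical all_reals all_analysis.

Set Implicit Arguments.
Unset Strict Implicit.
Unset Printing Implicit Defensive.

Import Order.TTheory GRing.Theory Num.Theory.

Local Open Scope classical_set_scope.
Local Open Scope ring_scope.

(** Machines *)

Definition machine_speeds (R : realType) (m : nat) (s : 'I_m -> R) : Prop :=
  [/\ (0 < m)%N, forall i, 0 < s i
    & forall i j : 'I_m, (i <= j)%N -> s j <= s i].

(* The sum of the [k] largest speeds; it is the total speed when [m <= k]. *)
Definition prefix_speed (R : realType) (m : nat) (s : 'I_m -> R) (k : nat) : R :=
  \sum_(i < m | (i < k)%N) s i.

Definition speed_classes (R : realType) (m K : nat) (s : 'I_m -> R)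
    (sigma : 'I_K -> R) (mult : 'I_K -> nat) : Prop :=
  [/\ forall l l' : 'I_K, (l < l')%N -> sigma l' < sigma l,
      forall i, exists l, s i = sigma l,
      forall l, mult l = #|[pred i | s i == sigma l]|
    & forall l, (0 < mult l)%N].

(** Instances *)

Record instance (R : realType) := Instance {
  job : finType;
  task : finType;
  owner : task -> job;
  weight : job -> R;
  requirement : task -> R;
  weight_gt0 : forall j, 0 < weight j;
  requirement_ge0 : forall v, 0 <= requirement v }.

Definition single_job (R : realType) (I : instance R) : Prop := #|job I| = 1%N.

(* [C v] is the completion time of task [v]; a job without tasks completes
   at time [0]. *)
Definition objective (R : realType) (I : instance R) (C : task I -> \bar R) :
    \bar R :=
  (\sum_(j : job I)
     (weight j)%:E * \big[maxe/0%E]_(v : task I | owner v == j) C v)%E.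

(** Offline schedules *)

(* [x i t] is the task run by machine [i] at time [t], if any.  Arbitrary
   measurable schedules are allowed, not only those with finitely many
   preemptions. *)
Definition feasible (R : realType) (m : nat) (I : instance R)
    (x : 'I_m -> R -> option (task I)) : Prop :=
  (forall i v, measurable [set t | x i t = Some v]) /\
  (forall (t : R) i i' v, 0 <= t -> x i t = Some v -> x i' t = Some v -> i = i').

Definition processed (R : realType) (m : nat) (s : 'I_m -> R) (I : instance R)
    (x : 'I_m -> R -> option (task I)) (v : task I) (t : R) : \bar R :=
  (\sum_(i < m)
     (s i)%:E *
     lebesgue_measure ([set u | 0 <= u <= t]%R `&` [set u | x i u = Some v]))%E.

(* This is [+oo] if the task never finishes. *)
Definition completion (R : realType) (m : nat) (s : 'I_m -> R) (I : instance R)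
    (x : 'I_m -> R -> option (task I)) (v : task I) : \bar R :=
  ereal_inf [set t%:E | t in
    [set t : R | 0 <= t /\ ((requirement v)%:E <= processed s x v t)%E]].

Definition opt (R : realType) (m : nat) (s : 'I_m -> R) (I : instance R) :
    \bar R :=
  ereal_inf [set objective (completion s x)
            | x in [set x : 'I_m -> R -> option (task I) | feasible x]].

(** The rate assignment for a set [T] of alive tasks *)

Definition share (R : realType) (I : instance R) (T : {set task I})
    (v : task I) : R :=
  weight (owner v) / #|[pred u in T | owner u == owner v]|%:R.

(* The state of the raising process: the current value of [tau], the frozen
   tasks, and the rates; the rates are meaningful on frozen tasks only. *)
Record filling (R : realType) (I : instance R) := Filling {
  level : R;
  frozen : {set task I};
  rate : task I -> R }.

Definition tentative (R : realType) (I : instance R) (T : {set task I})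
    (f : filling I) (tau : R) (v : task I) : R :=
  if v \in frozen f then rate f v else share T v * tau.

Definition tight (R : realType) (m : nat) (s : 'I_m -> R) (I : instance R)
    (L : task I -> R) (V : {set task I}) : bool :=
  \sum_(v in V) L v == prefix_speed s #|V|.

(* Frozen sets stay tight, so the next freezing happens when a tight set with
   an unfrozen element appears. *)
Definition next_level (R : realType) (m : nat) (s : 'I_m -> R) (I : instance R)
    (T : {set task I}) (f : filling I) : R :=
  inf [set tau : R | level f <= tau /\
    exists V : {set task I}, [/\ V \subset T, ~~ (V \subset frozen f)
                               & tight s (tentative T f tau) V]].

Definition freeze (R : realType) (m : nat) (s : 'I_m -> R) (I : instance R)
    (T : {set task I}) (f : filling I) : filling I :=
  let tau := next_level s T f in
  let L := tentative T f tau in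
  let V := odflt finset.set0
    [pick V : {set task I} |
       maxset [pred U : {set task I} | (U \subset T) && tight s L U] V] in
  Filling tau (frozen f :|: V)%SET L.

(* Every step freezes a new task as long as some task of [T] is unfrozen, so
   all of [T] is frozen after [#|T|] steps. *)
Definition rates (R : realType) (m : nat) (s : 'I_m -> R) (I : instance R)
    (T : {set task I}) : task I -> R :=
  rate (iter #|T| (freeze s T) (Filling 0 finset.set0 (fun=> 0))).

(** The run of the algorithm *)

Record run_state (R : realType) (I : instance R) := RunState {
  clock : R;
  remaining : task I -> R }.

Definition alive (R : realType) (I : instance R) (st : run_state I) :
    {set task I} :=
  [set v | 0 < remaining st v]%SET.

(* The rates depend only on the alive set, hence are constant up to the next
   time at which an alive task finishes; [next_event] moves to that time. *)
Definition time_to_event (R : realType) (m : nat) (s : 'I_m -> R)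
    (I : instance R) (st : run_state I) : R :=
  inf [set d : R | 0 <= d /\ exists2 v, v \in alive st
    & remaining st v <= d * rates s (alive st) v].

Definition next_event (R : realType) (m : nat) (s : 'I_m -> R)
    (I : instance R) (st : run_state I) : run_state I :=
  let d := time_to_event s st in
  RunState (clock st + d)
    (fun v => if v \in alive st
              then remaining st v - d * rates s (alive st) v
              else remaining st v).

Definition run (R : realType) (m : nat) (s : 'I_m -> R) (I : instance R)
    (k : nat) : run_state I :=
  iter k (next_event s (I := I)) (RunState 0 (@requirement R I)).

(* The clock at the first state in which [v] is not alive.  Every event
   finishes a task, so the search up to index [#|task I|] succeeds. *)
Definition alg_completion (R : realType) (m : nat) (s : 'I_m -> R)
    (I : instance R) (v : task I) : R :=
  clock (run s I
    (find (fun k => v \notin alive (run s I k)) (iota 0 #|task I|.+1))).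

Definition alg (R : realType) (m : nat) (s : 'I_m -> R) (I : instance R) :
    \bar R :=
  objective (fun v : task I => (alg_completion s v)%:E).

(** Competitiveness *)

(* The ratio [alg / opt] is at most [c] on all instances in [P]; multiplying
   out by [opt] covers the instances with [opt = 0]. *)
Definition competitive (R : realType) (m : nat) (s : 'I_m -> R)
    (P : instance R -> Prop) (c : R) : Prop :=
  forall I : instance R, P I -> (alg s I <= c%:E * opt s I)%E.

(* Main.v *)
(* With a single job all alive tasks have equal shares, so [n] alive tasks are
   all processed at rate [S_n / n], where [S_n] is the total speed of the [n]
   fastest machines, and tasks finish in the order of their requirements.  With
   requirements [q_1 >= q_2 >= ...] and [g k := k / S_k], the makespan is
   [sum_k q_k (g k - g (k-1))].  Any [k] tasks are processed at total rate at
   most [S_k], so an offline makespan [B] satisfies [q_1 + ... + q_k <= B S_k]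
   for all [k].  Under these constraints the fastest class contributes at most
   [B] to the sum, and every other class at most [2 B]; the ranks beyond the
   number of machines count as one more class, of speed [0].  The ratio is thus
   at most [2 K + 1]. *)
Require Import Defs.
From mathcomp Require Import all_boot all_order all_algebra.
From mathcomp Require Import all_classical all_reals all_analysis.
From mathcomp Require Import measurable_realfun ring lra.
Import Order.TTheory GRing.Theory Num.Theory.
Local Open Scope ring_scope.

Set Implicit Arguments.
Unset Strict Implicit.
Unset Printing Implicit Defensive.

(** * Prefix sums and speed classes *)

(* Here [A] is the partial makespan and [S], [Q] are the total speed and the
   total requirement of the first [n] ranks; [s], [q] belong to the next rank.
   Throughout a speed class, [P] bounds [S - n * s], which is constant there. *)
Lemma potential_step (F : realFieldType) (A B P Q S q s n : F) :
  0 < S -> 0 <= s -> 0 <= q -> 0 <= P -> Q <= B * S -> Q + q <= B * (S + s) ->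
  S - n * s <= P ->
  A + q * ((n + 1) / (S + s) - n / S) + (B * (S + s) - (Q + q)) * (P / (S + s) ^+ 2)
    + B * (P / (S + s))
  <= A + (B * S - Q) * (P / S ^+ 2) + B * (P / S).
Proof.
move=> S0 s0 q0 P0 QS QS' hP.
have S'0 : 0 < S + s by rewrite ltr_pwDl.
have -> : (n + 1) / (S + s) - n / S = (S - n * s) / (S * (S + s)).
  by field; rewrite !gt_eqF.
have h1 : q * ((S - n * s) / (S * (S + s))) <= q * (P / (S * (S + s))).
  by rewrite ler_wpM2l// ler_wpM2r// invr_ge0 mulr_ge0// ltW.
have h2 : (B * (S + s) - (Q + q)) * (P / (S + s) ^+ 2) <=
          (B * (S + s) - (Q + q)) * (P / (S * (S + s))).
  rewrite ler_wpM2l ?subr_ge0// ler_wpM2l// lef_pV2 ?posrE ?exprn_gt0 ?mulr_gt0//.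
  by rewrite expr2 ler_pM2r// lerDl.
have h3 : (B * S - Q) * (P / (S * (S + s))) <= (B * S - Q) * (P / S ^+ 2).
  rewrite ler_wpM2l ?subr_ge0// ler_wpM2l// lef_pV2 ?posrE ?exprn_gt0 ?mulr_gt0//.
  by rewrite expr2 ler_pM2l// lerDl.
have h4 : (B * (S + s) - (Q + q)) * (P / (S * (S + s))) + q * (P / (S * (S + s)))
   + B * (P / (S + s)) = (B * S - Q) * (P / (S * (S + s))) + B * (P / S).
  by field; rewrite !gt_eqF.
lra.
Qed.

(** The potential [A + (B * S - Q) * (P / S ^+ 2) + B * (P / S)] dominates [A]. It does not increase
    inside a class, and each class change raises its bound by at most [2 * B]. *)
Lemma layered_sum_le (F : realFieldType) (s q : nat -> F) (c : nat -> nat) (B : F) :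
  0 < s 0%N -> (forall i, 0 <= s i) -> (forall i, 0 <= q i) ->
  (forall i, (c i <= c i.+1)%N) -> (forall i, c i = c i.+1 -> s i = s i.+1) ->
  (forall n, \sum_(i < n) q i <= B * \sum_(i < n) s i) ->
  forall n, \sum_(i < n.+1)
      q i * (i.+1%:R / \sum_(j < i.+1) s j - i%:R / \sum_(j < i) s j)
    <= B * ((c n).*2.+1)%:R.
Proof.
move=> s00 s0 q0 cS cs qB.
pose S n := \sum_(i < n) s i; pose Q n := \sum_(i < n) q i.
pose A n := \sum_(i < n) q i * (i.+1%:R / S i.+1 - i%:R / S i).
have SS n : S n.+1 = S n + s n by rewrite /S big_ord_recr.
have QS n : Q n.+1 = Q n + q n by rewrite /Q big_ord_recr.
have AS n : A n.+1 = A n + q n * (n.+1%:R / S n.+1 - n%:R / S n).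
  by rewrite /A big_ord_recr.
have Sp n : 0 < S n.+1.
  elim: n => [|n ih]; last by rewrite SS ltr_pwDl.
  by rewrite SS /S big_ord0 add0r.
have B0 : 0 <= B.
  have := qB 1%N; rewrite !big_ord1 => h.
  by rewrite -(pmulr_lge0 _ s00) (le_trans (q0 0%N)).
have step n P : 0 <= P -> S n.+1 - n.+1%:R * s n.+1 <= P ->
   A n.+2 + (B * S n.+2 - Q n.+2) * (P / S n.+2 ^+ 2) + B * (P / S n.+2) <=
   A n.+1 + (B * S n.+1 - Q n.+1) * (P / S n.+1 ^+ 2) + B * (P / S n.+1).
  move=> P0 hP; rewrite AS [S n.+2]SS [Q n.+2]QS -[n.+2%:R]natr1.
  by apply: potential_step => //; rewrite -?SS -?QS; apply: qB.
have inv n : exists P, [/\ 0 <= P, S n.+1 - n.+1%:R * s n <= P &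
   A n.+1 + (B * S n.+1 - Q n.+1) * (P / S n.+1 ^+ 2) + B * (P / S n.+1)
     <= B * ((c n).*2.+1)%:R].
  elim: n => [|n [P [P0 hP ih]]].
    (* After one rank [S] equals [s 0], so [P = 0] is admissible and the potential is just
       [q 0 / s 0], at most [B]. This is why the fastest class costs only [B]. *)
    exists 0; split => //; first by rewrite /S big_ord1 mul1r subrr.
    rewrite AS /A big_ord0 !mul0r !mulr0 !addr0 add0r subr0.
    have := qB 1%N; rewrite /S !big_ord1 => h.
    rewrite mulrA mulr1 ler_pdivrMr// (le_trans h)//.
    rewrite -mulrA ler_wpM2l// ler_peMl//.
    by rewrite ler1n.
  have := cS n; rewrite leq_eqVlt => /predU1P[e|lt].
    exists P; rewrite -e -(cs _ e); split => //.
      by rewrite [S n.+2]SS -(cs _ e) -[n.+2%:R]natr1; lra.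
    by apply: le_trans ih; apply: step; rewrite -?(cs _ e).
  (* a new speed class begins: [P] is reset to the current total speed *)
  have h0 : S n.+1 - n.+1%:R * s n.+1 <= S n.+1.
    by rewrite lerBlDr lerDl mulr_ge0.
  exists (S n.+1); split; first exact: ltW.
    by rewrite SS -[n.+2%:R]natr1; lra.
  apply: le_trans (step n _ (ltW (Sp n)) h0) _.
  have Sn : S n.+1 != 0 by rewrite gt_eqF.
  (* With [P = S] the two extra terms are [B - Q / S] and [B]: this is the factor two per class. *)
  have -> : (B * S n.+1 - Q n.+1) * (S n.+1 / S n.+1 ^+ 2) = B - Q n.+1 / S n.+1.
    by field.
  have Q0 : 0 <= Q n.+1 / S n.+1 by rewrite divr_ge0 ?(ltW (Sp n))// sumr_ge0.
  have A1 : A n.+1 <= B * ((c n).*2.+1)%:R.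
    apply: le_trans ih; rewrite -addrA lerDl addr_ge0// mulr_ge0//.
    - by rewrite subr_ge0; apply: qB.
    - by rewrite divr_ge0// sqr_ge0.
    - by rewrite divr_ge0// ltW.
  have : B * ((c n).*2.+1)%:R + B * 2 <= B * ((c n.+1).*2.+1)%:R.
    by rewrite -mulrDr ler_wpM2l// -natrD ler_nat addn2 ltnS -doubleS leq_double.
  by rewrite divff// mulr1; lra.
move=> n; have [P [P0 _]] := inv n; apply: le_trans.
rewrite -addrA lerDl addr_ge0// mulr_ge0//.
- by rewrite subr_ge0; apply: qB.
- by rewrite divr_ge0// sqr_ge0.
- by rewrite divr_ge0// ltW.
Qed.

(** * Speeds and rates *)

(** Extension by zero lets the ranks beyond the last machine form one more class. *)
Definition speed_at (R : realType) (m : nat) (s : 'I_m -> R) (i : nat) : R :=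
  oapp s 0 (insub i).

Section Speeds.
Variables (R : realType) (m : nat) (s : 'I_m -> R).
Hypothesis ms : machine_speeds s.

Lemma speed_at_ge0 i : 0 <= speed_at s i.
Proof.
case: ms => _ s0 _; rewrite /speed_at.
by case: insubP => //= j _ _; exact: ltW.
Qed.

Lemma speed_at_lt i (h : (i < m)%N) : speed_at s i = s (Ordinal h).
Proof. by rewrite /speed_at insubT. Qed.

Lemma speed_at_ge i : (m <= i)%N -> speed_at s i = 0.
Proof. by rewrite leqNgt => h; rewrite /speed_at insubN. Qed.

Lemma speed_at_anti i j : (i <= j)%N -> speed_at s j <= speed_at s i.
Proof.
move=> ij; have [jm|mj] := ltnP j m; last by rewrite (speed_at_ge mj) speed_at_ge0.
case: ms => _ _ sa.
by rewrite (speed_at_lt jm) (speed_at_lt (leq_ltn_trans ij jm)) sa.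
Qed.

Lemma prefix_speedE k : prefix_speed s k = \sum_(i < k) speed_at s i.
Proof.
elim: k => [|k ih]; first by rewrite big_ord0 /prefix_speed big_pred0.
rewrite big_ord_recr /= -ih /prefix_speed.
have [km|mk] := ltnP k m.
  rewrite (bigD1 (Ordinal km))//= addrC (speed_at_lt km); congr (_ + _).
  apply: eq_bigl => i; rewrite ltnS [in RHS]ltn_neqAle andbC.
  by congr (_ && _).
rewrite (speed_at_ge mk) addr0; apply: eq_bigl => i.
by rewrite ltnS !(leq_trans (ltn_ord i))// ltnW// (leq_trans (ltn_ord i)).
Qed.

Lemma prefix_speed_gt0 k : (0 < k)%N -> 0 < prefix_speed s k.
Proof.
case: k => // k _; rewrite prefix_speedE big_ord_recl ltr_pwDl//.
  by case: ms => m0 s0 _; rewrite (speed_at_lt m0).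
by rewrite sumr_ge0// => i _; apply: speed_at_ge0.
Qed.

Lemma prefix_speed_le k n : (k <= n)%N -> prefix_speed s k <= prefix_speed s n.
Proof.
move=> /subnK <-; elim: (n - k)%N => // d ih.
rewrite addSn [leRHS]prefix_speedE big_ord_recr/= -prefix_speedE.
by rewrite (le_trans ih)// lerDl speed_at_ge0.
Qed.

(** Every added speed is at most each of the first [k], so the average speed of the fastest machines
    cannot grow with their number. *)
Lemma prefix_speed_avg k n : (k <= n)%N ->
  k%:R * prefix_speed s n <= n%:R * prefix_speed s k.
Proof.
move=> /subnK <-; elim: (n - k)%N => // d ih.
rewrite addSn -natr1 [prefix_speed s _.+1]prefix_speedE big_ord_recr/= -prefix_speedE.
rewrite mulrDr mulrDl mul1r lerD// prefix_speedE mulr_natl.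
rewrite -[k in _ *+ k]card_ord -sumr_const ler_sum// => i _.
by apply: speed_at_anti; rewrite (leq_trans (ltnW (ltn_ord i))) ?leq_addl.
Qed.

End Speeds.

(** With equal shares [w / n], a set of [k] tasks becomes tight at level [n * S_k / (k * w)], which
    by [prefix_speed_avg] is smallest at [k = n]. Hence the first freezing takes all of [T]. *)
Lemma rates_single_job (R : realType) (m : nat) (s : 'I_m -> R) (I : instance R)
    (T : {set task I}) (v : task I) :
  machine_speeds s -> single_job I -> v \in T ->
  rates s T v = prefix_speed s #|T| / #|T|%:R.
Proof.
move=> ms sj vT; have [j0 j0P] := fintype1 sj.
pose w := weight j0; pose n := #|T|; pose S := prefix_speed s n.
have w0 : 0 < w := weight_gt0 j0.
have n0 : (0 < n)%N by rewrite card_gt0; apply/set0Pn; exists v.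
have nR : 0 < n%:R :> R by rewrite ltr0n.
have shE u : share T u = w / n%:R.
  rewrite /share [owner u]j0P; congr (_ / _%:R).
  by apply: eq_card => u'; rewrite inE [owner u']j0P eqxx andbT.
pose f0 : filling I := Filling 0 finset.set0 (fun=> 0).
have tent tau u : tentative T f0 tau u = w / n%:R * tau.
  by rewrite /tentative /= finset.in_set0 shE.
have tightE tau (V : {set task I}) :
    tight s (tentative T f0 tau) V =
    (#|V|%:R * (w / n%:R * tau) == prefix_speed s #|V|).
  by rewrite /tight (eq_bigr _ (fun u _ => tent tau u)) sumr_const mulr_natl.
have tightT : tight s (tentative T f0 (S / w)) T.
  by rewrite tightE -/n -/S; apply/eqP; field; rewrite !gt_eqF.
have lvl : next_level s T f0 = S / w.
  apply/eqP; rewrite eq_le; apply/andP; split.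
    apply: ge_inf; first by exists 0 => tau [].
    split; first by rewrite /= divr_ge0 ?ltW// prefix_speed_gt0.
    by exists T; split => //; rewrite finset.subset0 -card_gt0.
  apply: lb_le_inf.
    exists (S / w); split; first by rewrite /= divr_ge0 ?ltW// prefix_speed_gt0.
    by exists T; split => //; apply/negP => /subset_leq_card; rewrite cards0 leqNgt n0.
  move=> tau [_ [V [VT VN]]]; rewrite tightE => /eqP e.
  have V0 : (0 < #|V|)%N by rewrite card_gt0 -finset.subset0.
  have := prefix_speed_avg ms (subset_leq_card VT); rewrite -/n -/S -e.
  have -> : n%:R * (#|V|%:R * (w / n%:R * tau)) = #|V|%:R * (w * tau).
    by field; rewrite gt_eqF.
  by rewrite ler_pM2l ?ltr0n// ler_pdivrMr// mulrC.
(* The first iteration establishes [inv]; later ones keep it, since frozen tasks retain their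
   rates. *)
pose inv (f : filling I) := frozen f = T /\ forall u, u \in T -> rate f u = S / n%:R.
have base : inv (freeze s T f0).
  rewrite /freeze lvl; split; last first.
    by move=> u uT /=; rewrite tent; field; rewrite !gt_eqF.
  (* [T] is itself tight and contains every candidate, so it is the only maximal one. *)
  rewrite /= finset.set0U; case: pickP => [V /maxsetP[/andP[VT _] /(_ T)]|/(_ T)] /=.
    by rewrite subxx tightT => <-.
  case/negP; apply/maxsetP; split; first by rewrite /= subxx tightT.
  by move=> B /andP[BT _] TB; apply/eqP; rewrite finset.eqEsubset BT.
have step f : inv f -> inv (freeze s T f).
  move=> [fT fr]; split => [|u uT]; last by rewrite /= /tentative fT uT fr.
  rewrite /= fT; apply/finset.setUidPl; case: pickP => [V /maxsetP[/andP[] //]|_] /=.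
  by rewrite finset.sub0set.
suff H k : (0 < k)%N -> inv (iter k (freeze s T) f0) by apply: (H n n0).2.
by elim: k => // -[|k] ih _ //; rewrite iterS; apply/step/ih.
Qed.

(** * Volume bound for offline schedules *)

(** Exchange argument: after subtracting the threshold speed [c], the first [k] ranks carry all the
    positive terms. Both sums have [k] terms, so the shift cancels. *)
Lemma sum_le_prefix_speed (R : realType) (m : nat) (s : 'I_m -> R) (A : {set 'I_m}) :
  machine_speeds s -> \sum_(i in A) s i <= prefix_speed s #|A|.
Proof.
move=> ms; case: (ms) => _ s0 _; have s0' i : 0 <= s i by exact: ltW.
set k := #|A|; pose c := speed_at s k.
have km : (k <= m)%N by rewrite -[leqRHS]card_ord max_card.
have sE (i : 'I_m) : s i = speed_at s i.
  by rewrite (speed_at_lt _ (ltn_ord i)); congr s; exact: val_inj.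
have h : \sum_(i in A) (s i - c) <= \sum_(i < m | (i < k)%N) (s i - c).
  rewrite [leLHS]big_mkcond [leRHS]big_mkcond ler_sum// => i _.
  have [ik|ki] := ltnP i k; last first.
    by case: ifP => // _; rewrite subr_le0 sE speed_at_anti.
  case: ifP => // _; rewrite subr_ge0 sE speed_at_anti//; exact: ltnW.
move: h; rewrite !big_split/= !sumr_const.
have -> : #|(fun i : 'I_m => (i < k)%N)| = k.
  by rewrite -sum1_card -(big_ord_widen _ (fun=> 1%N) km) sum1_card card_ord.
by rewrite lerD2r.
Qed.

Lemma nonneg_le_itv (R : realType) (t : R) :
  [set u | 0 <= u <= t]%R%classic = `[0, t]%classic.
Proof. by apply/seteqP; split => u /=; rewrite in_itv. Qed.

Section OptLowerBound.
Variables (R : realType) (m : nat) (s : 'I_m -> R) (I : instance R).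
Variable x : 'I_m -> R -> option (task I).
Hypotheses (ms : machine_speeds s) (fx : feasible x).
Local Notation mu := (@lebesgue_measure R).

Let speed_ge0 i : 0 <= s i.
Proof. by case: ms => _ s0 _; exact: ltW. Qed.

(** Machines busy with [V] run distinct tasks, so there are at most [#|V|] of them. *)
Lemma running_speed_le (V : {set task I}) (u : R) : 0 <= u ->
  \sum_(i < m) \sum_(v in V) s i * \1_[set w | x i w = Some v] u
    <= prefix_speed s #|V|.
Proof.
move=> u0; case: fx => _ inj.
pose A := [set i | [exists v in V, x i u == Some v]]%SET.
have cA : (#|A| <= #|V|)%N.
  have [->|/finset.set0Pn[i0 i0A]] := eqVneq A finset.set0; first by rewrite cards0.
  move: (i0A); rewrite inE => /existsP[v0 _].
  (* [f] sends a busy machine to its task; [v0] is a dummy never reached on [A]. *)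
  pose f i := odflt v0 (x i u).
  rewrite -(@card_in_imset _ _ f).
    apply/subset_leq_card/fintype.subsetP => _ /imsetP[i /[!inE] + ->].
    move=> /existsP[v /andP[vV /eqP e]].
    by rewrite /f e.
  move=> i j; rewrite !inE.
  move=> /existsP[v /andP[_ /eqP e]] /existsP[v' /andP[_ /eqP e']].
  by rewrite /f e e' /= => vv'; apply: (inj u i j v) => //; rewrite vv'.
apply: le_trans (prefix_speed_le ms cA).
apply: le_trans (sum_le_prefix_speed A ms).
rewrite [leRHS]big_mkcond ler_sum// => i _.
rewrite -mulr_sumr; case: ifPn => iA; last first.
  rewrite big1 ?mulr0// => v vV; rewrite indicE memNset//= => e.
  by move/negP: iA; apply; rewrite inE; apply/existsP; exists v; rewrite vV e eqxx.
rewrite ler_piMr//; have := iA; rewrite inE => /existsP[v /andP[vV /eqP e]].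
rewrite (bigD1 v)//= big1 ?addr0; first by rewrite indicE; case: (_ \in _).
by move=> v' /andP[_ v'v]; rewrite indicE memNset//= e => -[e']; rewrite e' eqxx in v'v.
Qed.

(** Measures are rewritten as integrals of indicators, and the pointwise bound [running_speed_le] is
    integrated over [[0, t]]. *)
Lemma processed_le (V : {set task I}) (t : R) : 0 <= t ->
  (\sum_(v in V) processed s x v t <= (t * prefix_speed s #|V|)%:E)%E.
Proof.
move=> t0; case: (fx) => mx _.
set D := [set u : R | 0 <= u <= t]%classic.
have D_itv : D = `[0, t]%classic by exact: nonneg_le_itv.
have mD : measurable D by rewrite D_itv; exact: measurable_itv.
pose g i v (u : R) := ((s i)%:E * (\1_[set w | x i w = Some v] u)%:E)%E.
have mg i v : measurable_fun D (g i v).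
  apply: measurable_funeM; apply/measurable_EFinP; apply: measurable_indic.
  exact: mx.
have g0 i v u : D u -> (0 <= g i v u)%E.
  by move=> _; rewrite /g -EFinM lee_fin mulr_ge0.
have Ig i v : (\int[mu]_(u in D) g i v u =
    (s i)%:E * mu (D `&` [set w | x i w = Some v]%classic))%E.
  rewrite ge0_integralZl_EFin//; last first.
    by apply/measurable_EFinP; apply: measurable_indic; exact: mx.
  by rewrite integral_indic// 1?setIC//; exact: mx.
have -> : (\sum_(v in V) processed s x v t =
    \int[mu]_(u in D) \sum_(i < m) \sum_(v <- enum V) g i v u)%E.
  rewrite ge0_integral_sum//; first last.
  - by move=> i u Du; apply: sume_ge0 => v _; exact: g0.
  - by move=> i; exact: (@emeasurable_sum _ _ R D _ (enum V) (g i)).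
  rewrite exchange_big/=; apply: eq_bigr => i _.
  rewrite ge0_integral_sum//; [|exact: mg|exact: g0].
  by rewrite [RHS]big_enum; apply: eq_bigr => v _; rewrite Ig.
have le_int : (\int[mu]_(u in D) (\sum_(i < m) \sum_(v <- enum V) g i v u) <=
    \int[mu]_(u in D) (cst (prefix_speed s #|V|)%:E) u)%E.
  apply: ge0_le_integral => //=.
  - by move=> u Du; apply: sume_ge0 => i _; apply: sume_ge0 => v _; exact: g0.
  - apply: (@emeasurable_sum _ _ R D _ _
      (fun i u => \sum_(v <- enum V) g i v u)%E) => i.
    exact: (@emeasurable_sum _ _ R D _ (enum V) (g i)).
  - move=> u /andP[u0 _]; have := running_speed_le V u0.
    rewrite -lee_fin -sumEFin; apply: le_trans; apply: lee_sum => i _.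
    rewrite -sumEFin big_enum; apply: lee_sum => v _.
    by rewrite /g EFinM.
apply: le_trans le_int _.
rewrite integral_cst//= D_itv lebesgue_measure_itv/= lte_fin.
case: ltP => [_|t'0]; first by rewrite oppr0 adde0 -EFinM mulrC.
by rewrite mule0 lee_fin mulr_ge0// sumr_ge0.
Qed.

Lemma opt_lower_bound (V : {set task I}) (C : R) :
  (forall v, v \in V -> (completion s x v <= C%:E)%E) -> 0 <= C ->
  \sum_(v in V) requirement v <= C * prefix_speed s #|V|.
Proof.
move=> hC C0.
have S0 : 0 <= prefix_speed s #|V| by rewrite sumr_ge0.
(* A completion time is an infimum, so the volume is bounded at every [t > C] first, and then [t]
   tends to [C]. *)
have ht t : C < t -> \sum_(v in V) requirement v <= t * prefix_speed s #|V|.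
  move=> Ct; have t0 : 0 <= t by exact/(le_trans C0)/ltW.
  rewrite -lee_fin; apply: le_trans (processed_le V t0).
  rewrite -sumEFin; apply: lee_sum => v vV.
  have /ereal_inf_ltP[_ [t' [t'0 req] <-]] : (completion s x v < t%:E)%E.
    by rewrite (le_lt_trans (hC _ vV))// lte_fin.
  rewrite lte_fin => t't; apply: le_trans req _; apply: lee_sum => i _.
  apply: lee_wpmul2l; first by rewrite lee_fin.
  apply: le_measure; rewrite ?inE.
  - by rewrite nonneg_le_itv; apply: measurableI; [exact: measurable_itv|exact: fx.1].
  - by rewrite nonneg_le_itv; apply: measurableI; [exact: measurable_itv|exact: fx.1].
  by apply: setSI => u /= /andP[-> ut']; rewrite (le_trans ut')// ltW.
have [S_eq0|Sneq0] := eqVneq (prefix_speed s #|V|) 0.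
  by have := ht (C + 1); rewrite S_eq0 !mulr0; apply; rewrite ltrDl.
have Sp : 0 < prefix_speed s #|V| by rewrite lt_def Sneq0.
rewrite -ler_pdivrMr//; apply/ler_addgt0Pr => e e0.
by rewrite ler_pdivrMr// ht// ltrDl.
Qed.

End OptLowerBound.

(** * The run on a single job *)

(** In a nonincreasing list the entries above [X] form an initial segment; [0 <= X] excludes the
    default [0] past its end. *)
Lemma count_gt_sorted (F : realDomainType) (X : F) (q : seq F) (j : nat) :
  0 <= X -> sorted >=%R q -> (j < count (> X) q)%N = (X < q`_j).
Proof.
move=> X0; elim: q j => [|a q ih] j.
  by move=> _ /=; rewrite nth_nil ltn0 ltNge X0.
rewrite /= (path_sortedE (rev_trans le_trans)) => /andP[aq sq].
have [Xa|aX] := ltP X a; first by case: j => [|j]; rewrite ?add1n ?ltnS/= ?ih.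
rewrite add0n (_ : count _ _ = 0%N); last first.
  apply/eqP; rewrite -leqn0 leqNgt -has_count -all_predC.
  by apply: sub_all aq => b /= ba; rewrite -leNgt (le_trans ba).
rewrite ltn0; apply/esym/negbTE; rewrite -leNgt.
case: j => [|j]//=; have [jq|qj] := ltnP j (size q); last by rewrite nth_default.
by rewrite (le_trans _ aX)//; move/allP: aq; apply; rewrite mem_nth.
Qed.

Section Run.
Variables (R : realType) (m : nat) (s : 'I_m -> R) (I : instance R).
Hypotheses (ms : machine_speeds s) (sj : single_job I).

Definition sorted_tasks : seq (task I) :=
  sort (fun u v => requirement v <= requirement u) (enum (task I)).

Definition sorted_requirements : seq R := map (@requirement R I) sorted_tasks.

Lemma sorted_requirementsP : sorted >=%R sorted_requirements.
Proof.
rewrite /sorted_requirements sorted_map; apply: sort_sorted.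
by move=> u v; exact: le_total.
Qed.

Lemma sorted_requirements_ge0 j : 0 <= sorted_requirements`_j.
Proof.
have [jq|qj] := ltnP j (size sorted_requirements); last by rewrite nth_default.
by have /mapP[v _ ->] := mem_nth 0 jq; exact: requirement_ge0.
Qed.

Lemma count_requirements_gt X :
  count (> X) sorted_requirements = #|[set v : task I | (X < requirement v)%R]%SET|.
Proof.
rewrite /sorted_requirements count_map (permP (permEl (perm_sort _ _))).
rewrite cardE -size_filter {2}/enum_mem -enumT; congr size.
by apply: eq_filter => v; rewrite /= inE.
Qed.

(* The junk value [0 / 0 = 0] at [j = 0] is the intended one. *)
Definition inv_speed_increment (j : nat) : R :=
  j.+1%:R / (\sum_(i < j.+1) speed_at s i) - j%:R / (\sum_(i < j) speed_at s i).

Lemma sum_inv_speed_increment n :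
  \sum_(j < n) inv_speed_increment j = n%:R / prefix_speed s n.
Proof.
rewrite prefix_speedE -(big_mkord xpredT inv_speed_increment).
rewrite (telescope_sumr (fun j => j%:R / (\sum_(i < j) speed_at s i)))//.
by rewrite mul0r subr0.
Qed.

(* [X] is the amount of processing received by every task that is still alive. *)
Lemma runE k : exists X : R, [/\ 0 <= X,
  forall v, remaining (run s I k) v = Num.max (requirement v - X) 0 &
  clock (run s I k) = \sum_(j < #|task I|)
    Num.min sorted_requirements`_j X * inv_speed_increment j].
Proof.
elim: k => [|k [X [X0 remE clkE]]].
  exists 0; split => // [v|]; first by rewrite subr0; apply/esym/max_idPl/requirement_ge0.
  by rewrite big1// => j _; rewrite min_r ?mul0r// sorted_requirements_ge0.
rewrite /run iterS -/(run s I k) /next_event.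
set st := run s I k in remE clkE *; set d := time_to_event s st => /=.
have aliveE v : (v \in alive st) = (X < requirement v).
  by rewrite inE remE lt_max ltxx orbF subr_gt0.
have remA v : v \in alive st -> remaining st v = requirement v - X.
  by rewrite aliveE remE => Xv; apply/max_idPl; rewrite subr_ge0 ltW.
(* With no task alive, the infimum of the empty set is [0] and the state is stationary. *)
have [A0|/finset.set0Pn[v0 v0A]] := eqVneq (alive st) finset.set0.
  have d0 : d = 0.
    rewrite /d /time_to_event (_ : [set _ | _]%classic = classical_sets.set0) ?inf0//.
    by apply/seteqP; split => // r [_ [v]]; rewrite A0 finset.in_set0.
  exists X; split => //; last by rewrite d0 addr0.
  by move=> v; rewrite A0 finset.in_set0.
(* All alive tasks run at the same rate, so one of least requirement finishes next, and
   [requirement u] is the new [X]. *)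
pose u := [arg min_(u < v0 in alive st) requirement u]%O.
have [uA umin] : u \in alive st /\
    forall v, v \in alive st -> requirement u <= requirement v.
  by rewrite /u; case: arg_minP => // i iA imin; split.
pose n := #|alive st|; pose r := prefix_speed s n / n%:R.
have n0 : (0 < n)%N by rewrite card_gt0; apply/finset.set0Pn; exists v0.
have r0 : 0 < r by rewrite divr_gt0 ?ltr0n// prefix_speed_gt0.
have ratesE v : v \in alive st -> rates s (alive st) v = r.
  by move=> vA; exact: rates_single_job.
have Xu : X < requirement u by rewrite -aliveE.
have dE : d = (requirement u - X) / r.
  have dge0 : 0 <= (requirement u - X) / r by apply: divr_ge0; rewrite ?subr_ge0 ltW.
  have dmem : exists2 v, v \in alive st &
      remaining st v <= (requirement u - X) / r * rates s (alive st) v.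
    by exists u => //; rewrite ratesE// remA// divfK// gt_eqF.
  apply/eqP; rewrite eq_le; apply/andP; split.
    by apply: ge_inf => //; exists 0 => ? [].
  apply: lb_le_inf; first by exists ((requirement u - X) / r).
  move=> e [_ [v vA]]; rewrite ratesE// remA// -ler_pdivrMr//; apply: le_trans.
  by rewrite ler_pM2r ?invr_gt0// lerD2r umin.
exists (requirement u); split; first exact: requirement_ge0.
  move=> v; case: ifPn => vA.
    rewrite ratesE// remA// dE divfK ?gt_eqF//.
    by rewrite max_l ?subr_ge0 ?umin// opprB addrA subrK.
  rewrite remE; move: vA; rewrite aliveE -leNgt => vX.
  by rewrite !max_r// subr_le0// (le_trans vX)// ltW.
have nE j : (j < n)%N = (X < sorted_requirements`_j).
  rewrite -count_gt_sorted ?sorted_requirementsP// count_requirements_gt.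
  by congr (_ < _)%N; apply: eq_card => v; rewrite inE aliveE.
have nN : (n <= #|task I|)%N by exact: max_card.
(* Telescoping spreads [n / S_n] over the first [n] ranks, which by [nE] are those above [X]. *)
have -> : d = (requirement u - X) * \sum_(j < n) inv_speed_increment j.
  by rewrite sum_inv_speed_increment dE invf_div.
rewrite clkE mulr_sumr (big_ord_widen _ (fun j => (_ - _) * inv_speed_increment j) nN).
rewrite [X in _ + X]big_mkcond -big_split/=; apply: eq_bigr => j _; rewrite nE.
have [Xq|qX] := ltP; last by rewrite addr0 (min_l (le_trans qX (ltW Xu))).
rewrite min_r -?mulrDl ?(addrC X) ?subrK//.
(* An entry above [X >= 0] is not the default value, so it belongs to an alive task. *)
have : sorted_requirements`_j \in sorted_requirements.
  rewrite mem_nth// ltnNge; apply: contraTN Xq => qj.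
  by rewrite nth_default// -leNgt.
by move=> /mapP[v _ e]; rewrite e umin// aliveE -e.
Qed.

End Run.

(** * Makespan bound from the volume constraints *)

Lemma sum_nth_take (F : nmodType) (q : seq F) (k : nat) :
  \sum_(j < k) q`_j = \sum_(a <- take k q) a.
Proof.
elim: q k => [|a q ih] [|k] /=; rewrite ?big_ord0 ?big_nil//.
  by rewrite big1// => j _; rewrite nth_nil.
by rewrite big_ord_recl big_cons/= -ih.
Qed.

Section Bound.
Variables (R : realType) (m : nat) (s : 'I_m -> R) (I : instance R).
Hypotheses (ms : machine_speeds s) (sj : single_job I).
Variable B : R.
Hypothesis B0 : 0 <= B.
Hypothesis volume_le : forall V : {set task I},
  \sum_(v in V) requirement v <= B * prefix_speed s #|V|.

(** The first [k] entries belong to at most [k] distinct tasks; entries past the end of the list are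
    [0]. *)
Lemma sum_sorted_requirements_le k :
  \sum_(j < k) (sorted_requirements I)`_j <= B * \sum_(j < k) speed_at s j.
Proof.
rewrite sum_nth_take -map_take big_map -prefix_speedE.
have ut : uniq (take k (sorted_tasks I)) by rewrite take_uniq// sort_uniq enum_uniq.
pose V := [set v in take k (sorted_tasks I)]%SET.
have -> : \sum_(v <- take k (sorted_tasks I)) requirement v =
    \sum_(v in V) requirement v.
  by rewrite big_uniq//=; apply: eq_bigl => v; rewrite inE.
apply: (le_trans (volume_le V)); rewrite ler_wpM2l//; apply: prefix_speed_le => //.
by rewrite cardsE (card_uniqP ut) size_take_min geq_minl.
Qed.

(** Truncating requirements at [X] preserves the volume constraints, so [layered_sum_le] applies at
    every event; the event finishing a given task need not be located. *)
Lemma clock_le (c : nat -> nat) (K k : nat) :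
  (forall i, (c i <= c i.+1)%N) -> (forall i, (c i <= K)%N) ->
  (forall i, c i = c i.+1 -> speed_at s i = speed_at s i.+1) ->
  clock (run s I k) <= B * (K.*2.+1)%:R.
Proof.
move=> cS cK cs; have [X [X0 _ ->]] := runE ms sj k.
case: #|task I| => [|n]; first by rewrite big_ord0 mulr_ge0.
apply: (@le_trans _ _ (B * ((c n).*2.+1)%:R)); last first.
  by rewrite ler_wpM2l// ler_nat ltnS leq_double.
apply: (@layered_sum_le _ (speed_at s)
  (fun j => Num.min (sorted_requirements I)`_j X)) => //.
- by have := prefix_speed_gt0 ms (ltn0Sn 0); rewrite prefix_speedE big_ord1.
- by move=> i; apply: speed_at_ge0.
- by move=> i; rewrite le_min sorted_requirements_ge0.
- move=> l; apply: le_trans (sum_sorted_requirements_le l).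
  by apply: ler_sum => j _; rewrite ge_min lexx.
Qed.

End Bound.

(** [c] gives the class of each rank, and [K] beyond the last machine; it is monotone because both
    [s] and [sigma] decrease. *)
Lemma speed_classes_index (R : realType) (m K : nat) (s : 'I_m -> R)
    (sigma : 'I_K -> R) (mult : 'I_K -> nat) :
  machine_speeds s -> speed_classes s sigma mult ->
  exists c : nat -> nat, [/\ forall i, (c i <= c i.+1)%N, forall i, (c i <= K)%N &
    forall i, c i = c i.+1 -> speed_at s i = speed_at s i.+1].
Proof.
move=> [_ _ sa] [sigma_dec /choice[cl clP] _ _].
pose c i := oapp (fun j => nat_of_ord (cl j)) K (insub i).
have c_lt i (h : (i < m)%N) : c i = cl (Ordinal h) by rewrite /c insubT.
have c_ge i : (m <= i)%N -> c i = K by rewrite leqNgt => h; rewrite /c insubN.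
have cK i : (c i <= K)%N.
  by have [h|h] := ltnP i m; [rewrite c_lt ltnW|rewrite c_ge].
exists c; split => // i; last first.
  have [h'|h'] := ltnP i.+1 m.
    rewrite (c_lt _ (ltnW h')) (c_lt _ h').
    rewrite (speed_at_lt _ (ltnW h')) (speed_at_lt _ h').
    by move=> /val_inj e; rewrite !clP e.
  rewrite [c i.+1]c_ge// (speed_at_ge s h'); have [h|h] := ltnP i m.
    by rewrite c_lt => e; have := ltn_ord (cl (Ordinal h)); rewrite e ltnn.
  by rewrite speed_at_ge.
have [h'|h'] := ltnP i.+1 m; last by rewrite [c i.+1]c_ge.
rewrite (c_lt _ (ltnW h')) (c_lt _ h') leqNgt; apply/negP => /sigma_dec.
by rewrite -!clP ltNge sa.
Qed.

(** * The competitive ratio *)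

Lemma objective_single_job (R : realType) (I : instance R) (j : job I)
    (C : task I -> \bar R) :
  all_equal_to j -> objective C = ((weight j)%:E * \big[maxe/0]_v C v)%E.
Proof.
move=> jP; rewrite /objective (bigD1 j)//= big1 ?adde0.
  by congr (_ * _)%E; apply: eq_bigl => v; rewrite [owner v]jP eqxx.
by move=> j'; rewrite [j']jP eqxx.
Qed.

Theorem theorem4 (R : realType) :
  exists c : R, forall (m K : nat) (s : 'I_m -> R)
    (sigma : 'I_K -> R) (mult : 'I_K -> nat),
  machine_speeds s ->
  speed_classes s sigma mult ->
  (forall l l' : 'I_K, nat_of_ord l' = l.+1 -> 64%:R <= sigma l / sigma l') ->
  (forall l : 'I_K,
     2%:R * (\sum_(i < K | (i < l)%N) (mult i)%:R * sigma i)
       <= (mult l)%:R * sigma l) ->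
  competitive s (@single_job R) (c * K%:R ^+ 2).
Proof.
(* Since [K >= 1], the bound [2 * K + 1] is at most [3 * K], hence at most [3 * K ^ 2]. *)
exists 3 => m K s sigma mult ms sc _ _ I sj.
have [c [cS cK cs]] := speed_classes_index ms sc.
have [j jP] := fintype1 sj.
have K0 : (0 < K)%N.
  case: ms => m0 _ _; case: sc => _ /(_ (Ordinal m0))[l _] _ _.
  exact: leq_ltn_trans (ltn_ord l).
have r0 : 0 < 3 * K%:R ^+ 2 :> R by rewrite mulr_gt0// exprn_gt0// ltr0n.
have w0 := weight_gt0 j.
rewrite -lee_pdivrMl//; apply: le_ereal_inf_tmp => _ [x fx <-].
rewrite lee_pdivrMl// /alg !(objective_single_job _ jP).
set M := (\big[maxe/0]_v completion s x v)%E.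
have M0 : (0 <= M)%E by exact: bigmax_ge_id.
have CM v : (completion s x v <= M)%E by exact: le_bigmax.
(* A schedule that never finishes has infinite cost; otherwise its makespan is the real [B]. *)
case: M M0 CM => [B|_ _|//]; last by rewrite !gt0_muley ?lte_fin// leey.
rewrite lee_fin => B0 CB.
have volume_le (V : {set task I}) :
    \sum_(v in V) requirement v <= B * prefix_speed s #|V|.
  by apply: (opt_lower_bound ms fx) => // v _; exact: CB.
rewrite muleCA lee_pmul2l ?lte_fin//.
apply: bigmax_le => [|v _]; first by rewrite lee_fin mulr_ge0// ltW.
rewrite lee_fin; apply: le_trans (clock_le ms sj B0 volume_le _ cS cK cs) _.
rewrite mulrC ler_wpM2r// -natrX -natrM ler_nat.
rewrite (@leq_trans (3 * K))//.
  by rewrite !mulSn mul0n addn0 addnn -add1n leq_add2r.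
by rewrite leq_mul2l expnS expn1 leq_pmull.
Qed.
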